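(* Let $k\geq 2$ be an integer. Every $3k$-strong semicomplete digraph $D$ with $\delta^+(D)\geq 22k$ is $k$-linked.
   Context: All digraphs are finite and simple (no loops, no parallel arcs; a pair of opposite arcs $xy,yx$ is allowed). Paths are directed paths with distinct vertices; ''disjoint'' means vertex-disjoint. A digraph is semicomplete if there is at least one arc between any two distinct vertices. A digraph is $k$-strong if it has at least $k+1$ vertices and, after deleting any set of at most $k-1$ vertices, the remaining digraph contains a directed path from $x$ to $y$ for every ordered pair of distinct vertices $x,y$. A digraph $D$ is $k$-linked if $|V(D)|\geq 2k$ and for any $2k$ distinct vertices $x_1,\dots,x_k,y_1,\dots,y_k$ of $D$ there are disjoint paths $P_1,\dots,P_k$ with $P_i$ a path from $x_i$ to $y_i$ for each $i\in[k]$. $\delta^+(D)$ denotes the minimum out-degree of $D$. *)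

(* Defs.v *)
From mathcomp Require Import all_boot.

Set Implicit Arguments.
Unset Strict Implicit.
Unset Printing Implicit Defensive.

(* A digraph is a finType T of vertices with an irreflexive arc relation e. *)
Section Digraph.

Variables (T : finType) (e : rel T).

Definition semicomplete : Prop := forall x y : T, x != y -> e x y || e y x.

(* Following path.v, a path is given by its first vertex x and the sequence p
   of the remaining ones: its vertex sequence is x :: p. *)
Definition dipath (x y : T) (p : seq T) : bool :=
  [&& path e x p, last x p == y & uniq (x :: p)].

Definition outdeg (x : T) : nat := #|[set y | e x y]|.

(* The default value #|T| exceeds every out-degree, so it plays no role as
   soon as there is a vertex. *)
Definition min_outdeg : nat := \big[minn/#|T|]_(x : T) outdeg x.

Definition del_vertices (S : {set T}) : rel T :=
  [rel x y | [&& e x y, x \notin S & y \notin S]].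

Definition linked (k : nat) : Prop :=
  2 * k <= #|T| /\
  forall x y : 'I_k -> T,
    injective x -> injective y -> (forall i j, x i != y j) ->
    exists P : 'I_k -> seq T,
      (forall i, dipath (x i) (y i) (P i)) /\
      (forall i j, i != j -> [disjoint x i :: P i & x j :: P j]).

End Digraph.

Definition strong (T : finType) (e : rel T) (k : nat) : Prop :=
  k < #|T| /\
  forall S : {set T}, #|S| < k ->
  forall x y : T, x \notin S -> y \notin S -> x != y ->
    exists p : seq T, dipath (del_vertices e S) x y p.

(* Main.v *)
Require Import Defs.
From mathcomp Require Import all_boot.
From mathcomp Require Import zify.
From Stdlib Require Import Classical.

Set Implicit Arguments.
Unset Strict Implicit.
Unset Printing Implicit Defensive.

(** Let U be 3k non-terminal vertices of largest in-degree (counted among the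
    non-terminals).  If x_i has at least k out-neighbours outside U that
    dominate all but at most k vertices of U, reserve one of them, r_i.
    Deleting the x_i and the reserved vertices leaves a k-strong digraph, so
    Menger's theorem gives k disjoint paths from U to the y_i; take them of
    minimal total length.  By minimality a vertex u of U that starts no path
    has no arc to a path at position 2 or later, and an out-neighbour of u off
    the paths has none at position 3 or later.  Hence r_i dominates some such
    vertex u_i, and almost all out-neighbours of u_i (of x_i, if no r_i was
    reserved) avoid the paths and only have arcs to their first three vertices.
    Among 14k such out-neighbours one, z_i, has 7k in-neighbours.  As the start
    s_i of the path to y_i has at least the in-degree of z_i, either z_i or some
    other candidate has an arc to s_i, or there are 7k vertices w with
    z_i -> w -> s_i, one of which is free. *)

(** * Selection and counting arguments *)

Lemma ex_least (P : nat -> Prop) :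
  (exists n, P n) -> exists n, P n /\ forall m, P m -> n <= m.
Proof.
case=> n Pn; apply: NNPP => noleast.
have {Pn} : exists2 m, m <= n & P m by exists n.
elim: n => [|n IHn] [m le_mn Pm].
  by apply: noleast; exists m; split=> // m' _; lia.
apply: noleast; exists m; split=> // m' Pm'; rewrite leqNgt; apply/negP => lt.
apply: IHn; exists m' => //; lia.
Qed.

(** Values are fixed one index at a time. When an index is treated, the values used before it number
    fewer than k and serve as the forbidden set [F]. *)
Lemma greedy_choice (T : finType) (k : nat) (P : 'I_k -> T -> Prop) :
  (forall i (F : {set T}), #|F| < k -> exists z, z \notin F /\ P i z) ->
  exists f : 'I_k -> T, injective f /\ forall i, P i (f i).
Proof.
case: k P => [|k] P choiceP; first by exists (fun i : 'I_0 => False_rect T (notF (valP i))); split=> [[]|[]].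
have [z0 _] : exists z : T, True.
  by have [|z _] := choiceP ord0 set0; [rewrite cards0 | exists z].
suff ind n : n <= k.+1 -> exists f : 'I_k.+1 -> T,
    (forall i j : 'I_k.+1, i < n -> j < n -> f i = f j -> i = j) /\
    (forall i : 'I_k.+1, i < n -> P i (f i)).
  have [f [fI fP]] := ind _ (leqnn _).
  by exists f; split=> [i j /fI|i]; [apply | apply: fP].
elim: n => [|n IHn] le_nk; first by exists (fun=> z0).
have [f [fI fP]] := IHn (ltnW le_nk).
pose o := Ordinal le_nk.
have [|z [zF zP]] := choiceP o [set f i | i : 'I_k.+1 & i < n].
  apply: leq_ltn_trans (leq_imset_card _ _) _.
  apply: leq_trans (le_nk); rewrite ltnS -[leqRHS](card_ord n).
  apply: leq_trans (leq_imset_card (widen_ord (ltnW le_nk)) _).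
  apply: subset_leq_card; apply/subsetP => i; rewrite !inE => lt_in.
  by apply/imsetP; exists (Ordinal lt_in) => //; apply: val_inj.
have fz (i : 'I_k.+1) : i < n -> f i <> z.
  by move=> lt_in E; case/negP: zF; apply/imsetP; exists i; rewrite ?inE.
exists (fun i : 'I_k.+1 => if i < n then f i else z); split=> [i j|i].
  rewrite !ltnS => le_i le_j; case: ifP => lt_i; case: ifP => lt_j.
  - exact: fI.
  - by move/(fz _ lt_i).
  - by move/esym/(fz _ lt_j).
  - by move=> _; apply: val_inj => /=; lia.
rewrite ltnS => le_i; case: ifP => lt_i; first exact: fP.
suff -> : i = o by [].
by apply: val_inj => /=; lia.
Qed.

(** Averaging: inside [Z], in-degrees and out-degrees have the same sum, and by semicompleteness
    each vertex has in-degree plus out-degree at least |Z| - 1. If all in-degrees were below d, then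
    |Z| - 1 <= 2(d - 1), against 2d <= |Z|. *)
Lemma ex_large_indegree (T : finType) (e : rel T) (Z : {set T}) (d : nat) :
  semicomplete e -> 0 < #|Z| -> 2 * d <= #|Z| ->
  exists2 z, z \in Z & d <= #|[set w in Z | e w z]|.
Proof.
move=> sc Z0 dZ; apply/exists_inP; apply: contraT.
rewrite negb_exists => /forallP small.
have sumE : \sum_(z in Z) #|[set w in Z | e w z]| = \sum_(z in Z) #|[set w in Z | e z w]|.
  transitivity (\sum_(z in Z) \sum_(w in Z) (e w z : nat)).
    by apply: eq_bigr => z _; rewrite -sum1dep_card big_mkcondr.
  rewrite exchange_big /=.
  by apply: eq_bigr => z _; rewrite -sum1dep_card big_mkcondr.
have inE' : \sum_(z in Z) #|[set w in Z | e w z]| <= #|Z| * d.-1.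
  rewrite -sum_nat_const; apply: leq_sum => z zZ.
  by move: (small z); rewrite zZ /= -ltnNge => lt_d; rewrite -ltnS (ltn_predK lt_d).
have both : #|Z| * #|Z|.-1 <= \sum_(z in Z) (#|[set w in Z | e w z]| + #|[set w in Z | e z w]|).
  rewrite -sum_nat_const; apply: leq_sum => z zZ.
  have -> : #|Z|.-1 = #|Z :\ z| by rewrite (cardsD1 z Z) zZ.
  apply: leq_trans (leq_card_setU _ _); apply: subset_leq_card.
  apply/subsetP => w; rewrite !inE => /andP[wz wZ]; rewrite wZ /=; exact: sc.
rewrite big_split /= -sumE in both.
have : #|Z| * #|Z|.-1 <= #|Z| * (d.-1 * 2) by rewrite mulnA; lia.
have d0 : 0 < d.
  by case/card_gt0P: (Z0) => z zZ; move: (small z); rewrite zZ /= -ltnNge; apply: leq_ltn_trans.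
rewrite leq_pmul2l //; lia.
Qed.

Lemma ex_top_set (T : finType) (V : {set T}) (f : T -> nat) (m : nat) :
  m <= #|V| ->
  exists U : {set T}, [/\ U \subset V, #|U| = m &
    forall u v, u \in U -> v \in V :\: U -> f v <= f u].
Proof.
elim: m => [|m IHm] le_mV.
  by exists set0; split; rewrite ?sub0set ?cards0 // => u v; rewrite inE.
have [U [sUV cU topU]] := IHm (ltnW le_mV).
have /card_gt0P[v0 v0V] : 0 < #|V :\: U|.
  by rewrite cardsD (setIidPr sUV) cU subn_gt0.
(* The set grows by a maximiser of [f] on what remains, so the old members still dominate the rest
   and the new one does too. *)
have [v vV vmax] := @arg_maxnP T v0 (mem (V :\: U)) f v0V.
have vU : v \notin U by move: vV; rewrite !inE => /andP[].
have vV' : v \in V by move: vV; rewrite !inE => /andP[].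
exists (v |: U); split.
- by rewrite subUset sub1set vV' sUV.
- by rewrite cardsU1 vU cU.
- move=> u w; rewrite !inE negb_or -andbA => /orP[/eqP->|uU] /and3P[wv wU wV].
    by apply: vmax; rewrite /= !inE wU.
  by apply: topU; rewrite // inE wU.
Qed.

Lemma min_outdeg_le (T : finType) (e : rel T) (x : T) : min_outdeg e <= outdeg e x.
Proof.
rewrite /min_outdeg; have := mem_index_enum x.
elim: (index_enum T) => // a r IHr; rewrite big_cons inE => /orP[/eqP<-|/IHr].
  by rewrite geq_min leqnn.
by rewrite geq_min => ->; rewrite orbT.
Qed.

(** * Menger's theorem *)

Definition separates (T : finType) (r : rel T) (A B C : {set T}) : Prop :=
  forall a p, a \in A -> path r a p -> last a p \in B -> has (mem C) (a :: p).

Definition disjoint_paths (T : finType) (r : rel T) (A B : {set T}) (k : nat) :=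
  exists (s t : 'I_k -> T) (p : 'I_k -> seq T),
    (forall i, [/\ s i \in A, t i \in B & dipath r (s i) (t i) (p i)]) /\
    (forall i j, i != j -> [disjoint s i :: p i & s j :: p j]).

Lemma first_hit (T : eqType) (P : pred T) (a : T) (p : seq T) :
  has P (a :: p) ->
  exists p1 p2, [/\ p = p1 ++ p2, P (last a p1) & ~~ has P (belast a p1)].
Proof.
elim: p a => [|b p IHp] a.
  by rewrite /= orbF => Pa; exists [::], [::].
case Pa : (P a); first by exists [::], (b :: p).
rewrite /= Pa /= => /IHp[p1 [p2 [-> P1 P2]]].
by exists (b :: p1), p2; rewrite /= Pa.
Qed.

Lemma last_hit (T : eqType) (P : pred T) (a : T) (p : seq T) :
  has P (a :: p) ->
  exists p1 p2, [/\ p = p1 ++ p2, P (last a p1) & ~~ has P p2].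
Proof.
elim: p a => [|b p IHp] a.
  by rewrite /= orbF => Pa; exists [::], [::].
case hp : (has P (b :: p)).
  by have [p1 [p2 [-> P1 P2]]] := IHp _ hp; exists (b :: p1), p2.
rewrite -[has _ _]/(P a || has P (b :: p)) hp orbF => Pa.
by exists [::], (b :: p); rewrite hp.
Qed.

Definition del_arc (T : finType) (r : rel T) (x y : T) : rel T :=
  [rel u v | r u v && ((u, v) != (x, y))].

(** [belast a p] lists the vertices that the walk leaves; a walk that never leaves x cannot use the
    arc xy. *)
Lemma path_del_arc_src (T : finType) (r : rel T) (x y a : T) (p : seq T) :
  path r a p -> x \notin belast a p -> path (del_arc r x y) a p.
Proof.
elim: p a => //= b p IHp a /andP[rab pp]; rewrite inE negb_or => /andP[xa xp].
by rewrite IHp // /del_arc /= rab xpair_eqE (negbTE (_ : a != x)) // eq_sym.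
Qed.

Lemma path_del_arc_tgt (T : finType) (r : rel T) (x y a : T) (p : seq T) :
  path r a p -> y \notin p -> path (del_arc r x y) a p.
Proof.
elim: p a => //= b p IHp a /andP[rab pp]; rewrite inE negb_or => /andP[yb yp].
by rewrite IHp // /del_arc /= rab xpair_eqE (negbTE (_ : b != y)) 1?andbF // eq_sym.
Qed.

Lemma path_del_arcW (T : finType) (r : rel T) (x y a : T) (p : seq T) :
  path (del_arc r x y) a p -> path r a p.
Proof. by apply: sub_path => u v /andP[]. Qed.

Lemma inj_onto (T : finType) (k : nat) (f : 'I_k -> T) (P : {set T}) :
  injective f -> (forall i, f i \in P) -> #|P| <= k ->
  forall v, v \in P -> exists i, f i = v.
Proof.
move=> fI fP cP v vP.
have E : [set f i | i : 'I_k] = P.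
  apply/eqP; rewrite eqEcard card_imset // card_ord cP andbT.
  by apply/subsetP => _ /imsetP[i _ ->].
by move: vP; rewrite -E => /imsetP[i _ ->]; exists i.
Qed.

Lemma dipath_mem_last (T : finType) (r : rel T) (a b : T) (p : seq T) :
  dipath r a b p -> b \in a :: p.
Proof. by case/and3P=> _ /eqP <- _; rewrite mem_last. Qed.

(* Gluing step of Goering's proof of Menger's theorem. *)
Lemma glue_disjoint_paths (T : finType) (r : rel T) (A B C : {set T}) (x y : T) (k : nat) :
  r x y -> separates (del_arc r x y) A B C ->
  x \notin C -> y \notin C -> #|C| < k ->
  disjoint_paths (del_arc r x y) A (x |: C) k ->
  disjoint_paths (del_arc r x y) (y |: C) B k ->
  disjoint_paths r A B k.
Proof.
set r' := del_arc r x y => rxy sepC xC yC cC [s1 [t1 [p1 [H1 D1]]]] [s2 [t2 [p2 [H2 D2]]]].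
have s1A i : s1 i \in A by case: (H1 i).
have t1P i : t1 i \in x |: C by case: (H1 i).
have d1 i : dipath r' (s1 i) (t1 i) (p1 i) by case: (H1 i).
have s2Q i : s2 i \in y |: C by case: (H2 i).
have t2B i : t2 i \in B by case: (H2 i).
have d2 i : dipath r' (s2 i) (t2 i) (p2 i) by case: (H2 i).
have only1 i j v : v \in s1 i :: p1 i -> v \in s1 j :: p1 j -> i = j.
  move=> vi vj; apply/eqP; apply: contraT => /D1; rewrite disjoint_has.
  by case/hasP; exists v.
have only2 i j v : v \in s2 i :: p2 i -> v \in s2 j :: p2 j -> i = j.
  move=> vi vj; apply/eqP; apply: contraT => /D2; rewrite disjoint_has.
  by case/hasP; exists v.
have t1I : injective t1.
  move=> i j E; apply: (only1 _ _ (t1 i)); first exact: dipath_mem_last (d1 _).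
  by rewrite E; apply: dipath_mem_last (d1 _).
have s2I : injective s2.
  by move=> i j E; apply: (only2 _ _ (s2 i)); rewrite ?mem_head // E mem_head.
(* Since |C| < k, the set [x |: C] has at most k elements, so the k distinct ends exhaust it. Hence
   a path of the first family meets [x |: C] only at its end; dually for the second family and
   [y |: C]. *)
have onto1 := inj_onto t1I t1P (ltac:(rewrite cardsU1 xC; lia)).
have onto2 := inj_onto s2I s2Q (ltac:(rewrite cardsU1 yC; lia)).
have meet1 i v : v \in s1 i :: p1 i -> v \in x |: C -> v = t1 i.
  move=> vi /onto1[j E]; rewrite -E (only1 i j v) // -E.
  exact: dipath_mem_last (d1 _).
have meet2 i v : v \in s2 i :: p2 i -> v \in y |: C -> v = s2 i.
  by move=> vi /onto2[j E]; rewrite -E (only2 i j v) // -E mem_head.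
(* Matching of the ends [x |: C] with the starts [y |: C]: x goes to y, and C is fixed pointwise.
   The second path numbered [h i] continues the first path numbered i. *)
pose g v := if v == x then y else v.
have [h hE] : exists h : 'I_k -> 'I_k, forall i, s2 (h i) = g (t1 i).
  apply: (@fin_all_exists _ (fun=> 'I_k) (fun i j => s2 j = g (t1 i))) => i; apply: onto2; rewrite /g; case: eqP => [_|/eqP ne].
    by rewrite !inE eqxx.
  by move: (t1P i); rewrite !inE (negbTE ne) => /= ->; rewrite orbT.
have gI i j : g (t1 i) = g (t1 j) -> i = j.
  move=> E; apply: t1I; move: (t1P i) (t1P j) E; rewrite /g !inE.
  case: (t1 i =P x) => [->|_] /=; case: (t1 j =P x) => [->|_] //=.
    by move=> _ jC E; rewrite -E (negbTE yC) in jC.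
  by move=> iC _ E; rewrite E (negbTE yC) in iC.
have cross i j v : v \in s1 i :: p1 i -> v \in s2 (h j) :: p2 (h j) -> i = j.
  move=> vi vj; case: (boolP (v \in C)) => vC.
    have v1 : v = t1 i by apply: meet1; rewrite // !inE vC orbT.
    have v2 : v = s2 (h j) by apply: meet2; rewrite // !inE vC orbT.
    apply: gI; rewrite -[g (t1 j)]hE -v2 -v1 /g; case: eqP => // E.
    by rewrite -E vC in xC.
  (* If the two families met at v outside C, the first path up to v followed by the second path from
     v would be a walk from A to B without xy that misses C. *)
  exfalso.
  have [q1 [q1' [E1 L1 N1]]] : exists q1 q1', [/\ p1 i = q1 ++ q1', last (s1 i) q1 = v
      & forall c, c \in C -> c \notin s1 i :: q1].
    case/splitPl E: {1}(p1 i) / vi => [q1 q1' L]; exists q1, q1'; split=> // c cC'.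
    apply/negP => cq.
    have ct : c = t1 i.
      by apply: meet1; [rewrite E -cat_cons mem_cat cq | rewrite !inE cC' orbT].
    case/and3P: (d1 i) => _; rewrite E last_cat L => /eqP lt.
    case: q1' lt E => [/= lt _|b q1' lt _]; first by rewrite lt -ct cC' in vC.
    rewrite -cat_cons cat_uniq => /and3P[_ /hasPn hn _].
    by have := hn (t1 i); rewrite -{1}(lt : last b q1' = t1 i) mem_last => /(_ isT); rewrite /= -ct cq.
  have [q2 [q2' [E2 L2 N2]]] : exists q2 q2', [/\ p2 (h j) = q2 ++ q2', last (s2 (h j)) q2 = v
      & forall c, c \in C -> c \notin q2'].
    case/splitPl E: {1}(p2 (h j)) / vj => [q2 q2' L]; exists q2, q2'; split=> // c cC'.
    apply/negP => cq.
    have ct : c = s2 (h j).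
      by apply: meet2; [rewrite E inE mem_cat cq !orbT | rewrite !inE cC' orbT].
    by case/and3P: (d2 (h j)) => _ _ /= /andP[]; rewrite E mem_cat -ct cq orbT.
  have pw : path r' (s1 i) (q1 ++ q2').
    case/and3P: (d1 i) => + _ _; rewrite E1 cat_path => /andP[pq1 _].
    case/and3P: (d2 (h j)) => + _ _; rewrite E2 cat_path => /andP[_].
    by rewrite cat_path pq1 L2 L1.
  have := sepC _ _ (s1A i) pw.
  rewrite last_cat L1 -L2 -last_cat -E2.
  case/and3P: (d2 (h j)) => _ /eqP-> _ => /(_ (t2B _)).
  rewrite -cat_cons has_cat => /orP[] /hasP[c cq /= cC'].
    by have := N1 c cC'; rewrite cq.
  by have := N2 c cC'; rewrite cq.
(* A path ending at x continues through the arc xy, so y has to be listed; otherwise the common end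
   in C is already present and only the tail is appended. *)
pose W i := p1 i ++ (if t1 i == x then s2 (h i) :: p2 (h i) else p2 (h i)).
have pathW i : path r (s1 i) (W i).
  case/and3P: (d1 i) => /path_del_arcW pi1 /eqP li1 _.
  case/and3P: (d2 (h i)) => /path_del_arcW pi2 _ _.
  rewrite cat_path pi1 li1; move: pi2; rewrite hE /g; case: eqP => [->|ne] //= ->.
  by rewrite rxy.
have lastW i : last (s1 i) (W i) = t2 (h i).
  case/and3P: (d1 i) => _ /eqP li1 _; case/and3P: (d2 (h i)) => _ /eqP <- _.
  by rewrite last_cat li1 hE /g; case: eqP.
have subW i v : v \in s1 i :: W i -> v \in s1 i :: p1 i \/ v \in s2 (h i) :: p2 (h i).
  rewrite -cat_cons mem_cat => /orP[|]; first by left.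
  by case: ifP => _ ?; right; rewrite // inE; apply/orP; right.
have shortW i v : v \in s1 i :: shorten (s1 i) (W i) -> v \in s1 i :: W i.
  by case/shortenP: (pathW i) => q _ _ sq; rewrite !inE => /orP[->|/sq ->]; rewrite ?orbT.
exists s1, (fun i => t2 (h i)), (fun i => shorten (s1 i) (W i)).
split=> [i|i j ne].
  split=> //; rewrite /dipath -lastW.
  by case/shortenP: (pathW i) => q -> -> _; rewrite eqxx.
rewrite disjoint_has; apply/hasPn => v /shortW/subW vi; apply/negP => /= /shortW/subW vj.
case/eqP: ne; case: vi vj => [vi|vi] [vj|vj].
- exact: only1 vi vj.
- exact: cross vi vj.
- exact/esym/(cross _ _ _ vj vi).
- by apply: gI; rewrite -!hE (only2 _ _ _ vi vj).
Qed.

(** Induction on the number of arcs. If deleting xy creates a separator C with fewer than k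
    vertices, then [x |: C] and [y |: C] separate A from B in the original digraph. The induction
    hypothesis gives k paths from A to the former and k from the latter to B, and these are
    glued. *)
Lemma menger (T : finType) (r : rel T) (A B : {set T}) (k : nat) :
  (forall C, separates r A B C -> k <= #|C|) -> disjoint_paths r A B k.
Proof.
move: {2}_.+1 (ltnSn #|[set a : T * T | r a.1 a.2]|) => n.
elim: n r A B => // n IHn r A B le_n sepk.
have [/existsP[[x y] /= rxy]|none] := boolP [exists a : T * T, r a.1 a.2]; last first.
  have nor u v : r u v = false.
    by apply/negP => ruv; case/existsP: none; exists (u, v).
  (* Without arcs only trivial walks join A to B, so the intersection itself is a separator. *)
  have : k <= #|A :&: B|.
    apply: sepk => a [|b p] aA /=; first by rewrite inE aA orbF.
    by rewrite nor.
  move=> le_k; pose f (i : 'I_k) := enum_val (widen_ord le_k i).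
  have fI : injective f by move=> i j /enum_val_inj/(congr1 val) E; apply: val_inj.
  exists f, f, (fun=> [::]); split=> [i|i j ne].
    have := enum_valP (widen_ord le_k i); rewrite -/(f i) inE => /andP[-> ->].
    by rewrite /dipath /= eqxx.
  by rewrite disjoint_has /= orbF inE; apply: contra ne => /eqP/fI->.
pose r' := del_arc r x y.
have lt_n : #|[set a : T * T | r' a.1 a.2]| < n.
  rewrite ltnS in le_n; apply: leq_trans le_n; apply: proper_card; apply/properP; split.
    by apply/subsetP => a; rewrite !inE => /andP[].
  by exists (x, y); rewrite inE //= /r' /del_arc /= eqxx andbF.
have [sepk'|nsep] := classic (forall C, separates r' A B C -> k <= #|C|).
  have [s [t [p [H D]]]] := IHn r' A B lt_n sepk'.
  exists s, t, p; split=> // i; case: (H i) => -> -> /and3P[/path_del_arcW pp ll uu].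
  by split=> //; apply/and3P.
have [C sepC ltC] : exists2 C, separates r' A B C & #|C| < k.
  apply: NNPP => nC; apply: nsep => C sC; rewrite leqNgt; apply/negP => lt.
  by apply: nC; exists C.
have sepP : separates r A B (x |: C).
  move=> a p aA pp lB; have [xp|xp] := boolP (x \in a :: p).
    by apply/hasP; exists x; rewrite //= !inE eqxx.
  have : path r' a p.
    by apply: path_del_arc_src => //; apply: contra xp; apply: mem_belast.
  case/(sepC a p aA)/(_ lB)/hasP => c cp cC.
  by apply/hasP; exists c => //=; rewrite inE; apply/orP; right.
have sepQ : separates r A B (y |: C).
  move=> a p aA pp lB; have [yp|yp] := boolP (y \in a :: p).
    by apply/hasP; exists y; rewrite //= !inE eqxx.
  have : path r' a p.
    by apply: path_del_arc_tgt => //; apply: contra yp; rewrite inE => ->; rewrite orbT.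
  case/(sepC a p aA)/(_ lB)/hasP => c cp cC.
  by apply/hasP; exists c => //=; rewrite inE; apply/orP; right.
(* Otherwise [x |: C] equals C and is a separator of size below k. *)
have xC : x \notin C.
  by apply/negP => xC; have := sepk _ sepP; rewrite cardsU1 xC; lia.
have yC : y \notin C.
  by apply/negP => yC; have := sepk _ sepQ; rewrite cardsU1 yC; lia.
(* A set E separating A from [x |: C] without xy separates A from B with it: the part of a walk up
   to its first vertex in [x |: C] does not leave x, hence avoids xy and meets E. The other side
   uses the part after the last vertex in [y |: C]. *)
apply: (glue_disjoint_paths rxy sepC xC yC ltC); apply: IHn => // E sepE; apply: sepk.
  move=> a p aA pp lB; have [p1 [p2 [Ep lP nP]]] := first_hit (sepP a p aA pp lB).
  have : path r' a p1.
    apply: path_del_arc_src; first by move: pp; rewrite Ep cat_path => /andP[].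
    by apply: contra nP => xb; apply/hasP; exists x; rewrite //= !inE eqxx.
  case/(sepE a p1 aA)/(_ lP)/hasP => c cp cE; apply/hasP; exists c => //.
  by rewrite Ep -cat_cons mem_cat cp.
move=> a p aA pp lB; have [p1 [p2 [Ep lP nP]]] := last_hit (sepQ a p aA pp lB).
have : path r' (last a p1) p2.
  apply: path_del_arc_tgt; first by move: pp; rewrite Ep cat_path => /andP[].
  by apply: contra nP => xb; apply/hasP; exists y; rewrite //= !inE eqxx.
case/(sepE _ p2 lP)/(_ _)/hasP; first by rewrite -last_cat -Ep.
move=> c cp cE; apply/hasP; exists c => //.
move: cp; rewrite inE Ep -cat_cons mem_cat => /orP[/eqP->|->]; last by rewrite orbT.
by rewrite mem_last.
Qed.

(** A separator C with fewer than k vertices would miss some a in A and b in B. As [F :|: C] has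
    fewer than m vertices, strong connectivity joins a to b outside it. *)
Lemma strong_disjoint_paths (T : finType) (e : rel T) (m k : nat) (F A B : {set T}) :
  strong e m -> #|F| + k <= m -> k <= #|A| -> k <= #|B| ->
  [disjoint A & F] -> [disjoint B & F] -> [disjoint A & B] ->
  disjoint_paths (del_vertices e F) A B k.
Proof.
case=> _ str cF cA cB dAF dBF dAB; apply: menger => C sepC.
rewrite leqNgt; apply/negP => ltC.
have ex (D : {set T}) : k <= #|D| -> exists2 a, a \in D & a \notin C.
  move=> cD; have /card_gt0P[a] : 0 < #|D :\: C|.
    by rewrite cardsD subn_gt0; apply: leq_ltn_trans (leq_trans ltC cD); rewrite subset_leq_card ?subsetIr.
  by rewrite inE => /andP[? ?]; exists a.
have [a aA aC] := ex A cA; have [b bB bC] := ex B cB.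
have aF := disjointFr dAF aA; have bF := disjointFr dBF bB.
have ab : a != b by apply: contraTneq bB => <-; rewrite (disjointFr dAB aA).
have cFC : #|F :|: C| < m by apply: leq_ltn_trans (leq_card_setU _ _) _; lia.
have aFC : a \notin F :|: C by rewrite inE aF.
have bFC : b \notin F :|: C by rewrite inE bF.
have [p /and3P[pp /eqP lp _]] := str _ cFC _ _ aFC bFC ab.
have pp' : path (del_vertices e F) a p.
  apply: sub_path pp => u v /and3P[euv]; rewrite !inE !negb_or.
  by move=> /andP[uF _] /andP[vF _]; rewrite /del_vertices /= euv uF vF.
have := sepC a p aA pp'; rewrite lp => /(_ bB)/hasP[c cp /= cC].
move: cp; rewrite inE => /orP[/eqP ca|cp]; first by rewrite -ca cC in aC.
case/splitPr: cp pp => p1 p2; rewrite cat_path => /andP[_ /= /andP[/and3P[_ _]]].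
by rewrite inE (_ : c \in C) ?orbT.
Qed.

(** * Path systems of minimal total length *)

Definition path_system (T : finType) (r : rel T) (U : {set T}) (k : nat)
    (y s : 'I_k -> T) (p : 'I_k -> seq T) : Prop :=
  (forall i, [/\ s i \in U, path r (s i) (p i) & last (s i) (p i) = y i]) /\
  (forall i j v, v \in s i :: p i -> v \in s j :: p j -> i = j).

Definition min_path_system (T : finType) (r : rel T) (U : {set T}) (k : nat)
    (y s : 'I_k -> T) (p : 'I_k -> seq T) : Prop :=
  path_system r U y s p /\
  forall s' p', path_system r U y s' p' ->
    \sum_i size (p i) <= \sum_i size (p' i).

Lemma ex_min_path_system (T : finType) (r : rel T) (U : {set T}) (k : nat)
    (y : 'I_k -> T) :
  injective y -> disjoint_paths r U [set y i | i : 'I_k] k ->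
  exists s p, min_path_system r U y s p.
Proof.
move=> yI [s [t [p [H D]]]].
have tI : injective t.
  move=> i j E; apply/eqP; apply: contraT => /D; rewrite disjoint_has => /hasP[].
  have tmem l : t l \in s l :: p l by case: (H l) => _ _ /dipath_mem_last.
  by exists (t i); rewrite //= E.
have cY : #|[set y i | i : 'I_k]| <= k by rewrite card_imset // card_ord.
have tY i : t i \in [set y i | i : 'I_k] by case: (H i).
have onto := inj_onto tI tY cY.
(* The k distinct ends exhaust the targets, in an unknown order; [h] renumbers the paths so that the
   i-th one ends at [y i]. *)
have [h hE] : exists h : 'I_k -> 'I_k, forall i, t (h i) = y i.
  apply: (@fin_all_exists _ (fun=> 'I_k) (fun i j => t j = y i)) => i.
  by apply: onto; apply: imset_f.
have [|n [[s0 [p0 [sys0 <-]]] min0]] := @ex_least (fun n => exists s p,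
    path_system r U y s p /\ \sum_i size (p i) = n).
  exists (\sum_i size (p (h i))), (s \o h), (p \o h); split=> //; split=> [i|i j v vi vj] /=.
    by case: (H (h i)) => sU _ /and3P[pp /eqP lp _]; rewrite -hE.
  apply: yI; rewrite -!hE; congr (t _); apply/eqP; apply: contraT => /D.
  by rewrite disjoint_has => /hasP[]; exists v.
by exists s0, p0; split=> // s' p' sys'; apply: min0; exists s', p'.
Qed.

Lemma mem_split (T : eqType) (x : T) (p : seq T) :
  x \in p -> exists p1 p2, p = p1 ++ x :: p2.
Proof. by case/splitPr=> p1 p2; exists p1, p2. Qed.

Section MinimalSystem.

Variables (T : finType) (e : rel T) (F U : {set T}) (k : nat).
Variables (y s : 'I_k -> T) (p : 'I_k -> seq T).
Hypothesis minP : min_path_system (del_vertices e F) U y s p.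

(** Replacing line i by a walk that meets no other line gives a path system again, since lines may
    be walks; the other lengths cancel. *)
Lemma reroute_le i s0 p0 :
  s0 \in U -> path (del_vertices e F) s0 p0 -> last s0 p0 = y i ->
  (forall v j, v \in s0 :: p0 -> v \in s j :: p j -> j = i) ->
  size (p i) <= size p0.
Proof.
case: minP => -[sys dis] le s0U pp0 lp0 new.
have := le (fun j => if j == i then s0 else s j) (fun j => if j == i then p0 else p j).
rewrite (bigD1 i) //= [leqRHS](bigD1 i) //= eqxx.
rewrite [X in _ -> _ <= _ + X](eq_bigr (fun j => size (p j))); last first.
  by move=> j /negbTE->.
rewrite leq_add2r; apply; split=> [j|j l v].
  by case: eqP => [->|_].
case: eqP => [->|_]; case: eqP => [->|_] //.
- by move=> v0 vl; rewrite (new v l).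
- by move=> vj v0; rewrite (new v j).
- exact: dis.
Qed.

(** If u occurred later on line i, the tail from u would be a shorter replacement. *)
Lemma start_of_line i u : u \in U -> u \in s i :: p i -> u = s i.
Proof.
move=> uU; rewrite inE => /orP[/eqP //|/mem_split[p1 [p2 Ep]]].
have [[sys dis] _] := minP.
have [_] := sys i; rewrite Ep cat_path last_cat => /andP[_ /= /andP[_ pp]] lp.
have := @reroute_le i u p2 uU pp lp.
rewrite Ep size_cat /=; move=> le; suff : size p1 + (size p2).+1 <= size p2 by lia.
apply: le => v j vp vj; apply: dis vj _; rewrite inE Ep mem_cat; apply/orP; right.
by rewrite vp orbT.
Qed.

Hypothesis dUF : [disjoint U & F].

Lemma system_line_avoids i v : v \in s i :: p i -> v \notin F.
Proof.
case: minP => -[/(_ i)[sU pp _] _] _; rewrite inE => /orP[/eqP->|vp].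
  by rewrite (disjointFr dUF).
by case/splitPr: vp pp => p1 p2; rewrite cat_path => /andP[_ /= /andP[/and3P[]]].
Qed.

(** With [s i] at position 0, [behead (p i)] starts at position 2. The shortcut from u to q has a
    single arc before q, the line at least two. *)
Lemma no_jump i u q :
  u \in U -> (forall j, u \notin s j :: p j) -> q \in behead (p i) -> ~~ e u q.
Proof.
move=> uU uS qp; apply/negP => euq.
have qi : q \in s i :: p i by rewrite inE (mem_behead qp) orbT.
have qF := system_line_avoids qi.
have [[sys dis] _] := minP.
case Ep : (p i) qp => [|c p'] //= /mem_split[p1 [p2 Ep']]; rewrite {}Ep' in Ep.
have [_] := sys i; rewrite Ep /= cat_path last_cat => /andP[_ /andP[_ /= /andP[_ pp]]] lp.
have := @reroute_le i u (q :: p2) uU.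
have uq : del_vertices e F u q by rewrite /del_vertices /= euq qF (disjointFr dUF uU).
rewrite /= uq => /(_ pp lp).
rewrite Ep /= size_cat /=; move=> le; suff : (size p1 + (size p2).+1).+1 <= (size p2).+1 by lia.
apply: le => v j; rewrite inE => /orP[/eqP->|vp]; first by rewrite (negbTE (uS j)).
by move=> vj; apply: dis vj _; rewrite Ep !inE mem_cat vp !orbT.
Qed.

(** Here [drop 2 (p i)] starts at position 3, so the two arcs through z replace at least three. *)
Lemma no_jump2 i u z q :
  u \in U -> (forall j, u \notin s j :: p j) -> e u z ->
  z \notin F -> (forall j, z \notin s j :: p j) -> q \in drop 2 (p i) -> ~~ e z q.
Proof.
move=> uU uS euz zF zS qp; apply/negP => ezq.
have qi : q \in s i :: p i by rewrite inE (mem_drop qp) orbT.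
have qF := system_line_avoids qi.
have [[sys dis] _] := minP.
case Ep : (p i) qp => [|c [|c' p']] //=; rewrite drop0 => /mem_split[p1 [p2 Ep']]; rewrite {}Ep' in Ep.
have [_] := sys i; rewrite Ep /= cat_path last_cat.
case/and3P=> _ _ /andP[_ /= /andP[_ pp]] lp.
have := @reroute_le i u (z :: q :: p2) uU.
have uz : del_vertices e F u z by rewrite /del_vertices /= euz zF (disjointFr dUF uU).
have zq : del_vertices e F z q by rewrite /del_vertices /= ezq zF qF.
rewrite /= uz zq => /(_ pp lp).
rewrite Ep /= size_cat /=.
move=> le; suff : (size p1 + (size p2).+1).+2 <= (size p2).+2 by lia.
apply: le => v j; rewrite !inE => /or3P[/eqP->|/eqP->|vp].
- by have := uS j; rewrite inE => /negbTE->.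
- by have := zS j; rewrite inE => /negbTE->.
rewrite -in_cons => vj; apply: dis vj _; rewrite Ep !inE mem_cat.
by rewrite inE vp !orbT.
Qed.

End MinimalSystem.

(** * Linking the terminals by disjoint walks *)

Lemma card_leq_setD (T : finType) (A B : {set T}) : #|A| <= #|A :\: B| + #|B|.
Proof. by rewrite -(cardsID B A) addnC leq_add2l subset_leq_card ?subsetIr. Qed.

Lemma card_setU_le (T : finType) (A B : {set T}) : #|A :|: B| <= #|A| + #|B|.
Proof. exact: leq_card_setU. Qed.

Lemma card_lt_notin (T : finType) (A B : {set T}) :
  #|B| < #|A| -> exists2 a, a \in A & a \notin B.
Proof.
move=> lt; have := card_leq_setD A B => le.
have /card_gt0P[a] : 0 < #|A :\: B| by lia.
by rewrite inE => /andP[? ?]; exists a.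
Qed.

Lemma card_ord_image (T : finType) (k : nat) (f : 'I_k -> T) (J : {set 'I_k}) :
  #|f @: J| <= k.
Proof. by apply: leq_trans (leq_imset_card _ _) _; rewrite -[leqRHS](card_ord k) max_card. Qed.

Lemma semicomplete_arc (T : finType) (e : rel T) (a b : T) :
  semicomplete e -> a != b -> ~~ e a b -> e b a.
Proof. by move=> sc /sc/orP[->|]. Qed.

Lemma link_terminals (T : finType) (e : rel T) (k : nat) (x y : 'I_k -> T) :
  0 < k -> irreflexive e -> semicomplete e -> strong e (3 * k) ->
  (forall v, 22 * k <= outdeg e v) ->
  injective x -> injective y -> (forall i j, x i != y j) ->
  exists W : 'I_k -> seq T,
    (forall i, path e (x i) (W i) /\ last (x i) (W i) = y i) /\
    (forall i j v, v \in x i :: W i -> v \in x j :: W j -> i = j).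
Proof.
move=> k0 irr sc str deg xI yI xy.
pose o : 'I_k := Ordinal k0.
have cT : 22 * k <= #|T| by apply: leq_trans (deg (x o)) (max_card _).
pose X := [set x i | i : 'I_k]; pose Y := [set y i | i : 'I_k].
have cX : #|X| = k by rewrite card_imset // card_ord.
have cY : #|Y| = k by rewrite card_imset // card_ord.
pose V := ~: (X :|: Y).
have cV : 3 * k <= #|V|.
  have := cardsC (X :|: Y); have := card_setU_le X Y; rewrite -/V; lia.
pose N v := [set w in V | e w v].
have [U [sUV cU topU]] := ex_top_set (fun v => #|N v|) cV.
have UX u : u \in U -> u \notin X.
  by move/(subsetP sUV); rewrite !inE negb_or => /andP[].
have UY u : u \in U -> u \notin Y.
  by move/(subsetP sUV); rewrite !inE negb_or => /andP[].
(* A vertex of [V :\: U] outside [G] fails to dominate more than k vertices of U, and each of these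
   dominates it. *)
pose G := [set v in V :\: U | #|[set u in U | ~~ e v u]| <= k].
have GV v : v \in G -> [/\ v \notin X, v \notin Y & v \notin U].
  by rewrite !inE negb_or => /andP[/andP[vU /andP[vX vY]] _].
pose GN i := [set v in G | e (x i) v].
pose J := [set i | k <= #|GN i|].
have [r [rI rP]] : exists r : 'I_k -> T, injective r /\
    forall i, i \in J -> r i \in G /\ e (x i) (r i).
  apply: (@greedy_choice T k (fun i v => i \in J -> v \in G /\ e (x i) v)) => i Z cZ.
  have [iJ|niJ] := boolP (i \in J).
    have [|v] := @card_lt_notin T (GN i) Z; first by apply: leq_trans cZ _; rewrite inE in iJ.
    by rewrite inE => /andP[vG ev] vZ; exists v.
  (* Outside [J] the condition is vacuous, but a fresh vertex keeps [r] injective on all indices. *)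
  have [|v _ vZ] := @card_lt_notin T setT Z; first by rewrite cardsT; lia.
  by exists v; split=> // iJ; rewrite iJ in niJ.
pose R := r @: J.
have cR : #|R| <= k := card_ord_image _ _.
have RG v : v \in R -> v \in G by case/imsetP=> i /rP[? _] ->.
pose F := X :|: R.
have dUF : [disjoint U & F].
  rewrite disjoint_subset; apply/subsetP => u uU.
  rewrite /= !inE negb_or UX //=; apply/negP => /RG/GV[_ _].
  by rewrite uU.
have [s [p minP]] : exists s p, min_path_system (del_vertices e F) U y s p.
  (* [F] has at most 2k vertices, so 3k-strength leaves k for Menger's theorem. *)
  apply: ex_min_path_system => //; apply: (strong_disjoint_paths str) => //.
  - have := card_setU_le X R; rewrite -/F; lia.
  - lia.
  - by rewrite -/Y cY.
  - rewrite disjoint_subset; apply/subsetP => v /imsetP[i _ ->].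
    rewrite /= !inE negb_or; apply/andP; split.
      by apply/negP => /imsetP[j _ E]; have := xy j i; rewrite E eqxx.
    by apply/negP => /RG/GV[_ /imsetP[]]; exists i.
  - rewrite disjoint_subset; apply/subsetP => u uU.
    by rewrite inE UY.
have [[sys dis] _] := minP.
have sU i : s i \in U by case: (sys i).
have lineF := system_line_avoids minP dUF.
pose S := [set s i | i in [set: 'I_k]].
have cS : #|S| <= k := card_ord_image _ _.
have US u j : u \in U -> u \notin S -> u \notin s j :: p j.
  move=> uU; apply: contra => /(start_of_line minP uU) ->; exact: imset_f.
(* [H0] and [H1] collect positions 1 and 2 of the lines; a line that is too short contributes its
   start by default. *)
pose H0 := [set nth (s i) (p i) 0 | i in [set: 'I_k]].
pose H1 := [set nth (s i) (p i) 1 | i in [set: 'I_k]].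
have cH0 : #|H0| <= k := card_ord_image _ _.
have cH1 : #|H1| <= k := card_ord_image _ _.
have off_line u z j : u \in U -> u \notin S -> e u z -> z \notin U -> z \notin H0 ->
    z \notin s j :: p j.
  move=> uU uS euz zU zH; apply/negP; rewrite inE => /orP[/eqP E|zp].
    by rewrite E sU in zU.
  have uL l : u \notin s l :: p l by apply: US.
  have := no_jump minP dUF uU uL (i := j) (q := z); rewrite euz.
  case Ep : (p j) zp => [|c p'] //=; rewrite inE => /orP[/eqP E _|-> /(_ isT)] //.
  by case/imsetP: zH; exists j; rewrite // Ep /= E.
(* Positions 0, 1 and 2 lie in [S], [H0] and [H1]; later ones are excluded by [no_jump2], as z is
   off the lines. *)
have low_line u z j q : u \in U -> u \notin S -> e u z -> z \notin U -> z \notin H0 ->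
    z \notin F -> e z q -> q \in s j :: p j -> q \in S :|: H0 :|: H1.
  move=> uU uS euz zU zH zF ezq; rewrite inE => /orP[/eqP->|qp].
    by rewrite !inE imset_f.
  have uL l : u \notin s l :: p l by apply: US.
  have zL l : z \notin s l :: p l by apply: off_line euz _ _.
  have := no_jump2 minP dUF uU uL euz zF zL (i := j) (q := q); rewrite ezq.
  have j0 : nth (s j) (p j) 0 \in H0 by apply: imset_f.
  have j1 : nth (s j) (p j) 1 \in H1 by apply: imset_f.
  case Ep : (p j) j0 j1 qp => [|c [|c' p']] //= j0 j1.
    by rewrite inE => /eqP-> _; rewrite !in_setU j0 !orbT.
  by rewrite drop0 !inE => /or3P[/eqP->|/eqP->|-> /(_ isT)]; rewrite // ?j0 ?j1 ?orbT.
have [u [uI uP]] : exists u : 'I_k -> T, injective u /\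
    forall i, i \in J -> [/\ u i \in U, u i \notin S & e (r i) (u i)].
  apply: (@greedy_choice T k (fun i v => i \in J -> [/\ v \in U, v \notin S & e (r i) v])) => i Z cZ.
  have [iJ|niJ] := boolP (i \in J); last first.
    have [|v _ vZ] := @card_lt_notin T setT Z; first by rewrite cardsT; lia.
    by exists v; split=> // iJ; rewrite iJ in niJ.
  have [riG _] := rP _ iJ.
  have cM : #|[set u in U | ~~ e (r i) u]| <= k by move: riG; rewrite inE => /andP[].
  (* Of the 3k vertices of U, at most k start a line, at most k are not dominated by [r i], and
     fewer than k are already chosen. *)
  have [|v vU] := @card_lt_notin T U (S :|: [set u in U | ~~ e (r i) u] :|: Z).
    have := card_setU_le (S :|: [set u in U | ~~ e (r i) u]) Z.
    have := card_setU_le S [set u in U | ~~ e (r i) u]; lia.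
  rewrite !inE !negb_or vU /= negbK => /andP[/andP[vS ev] vZ].
  by exists v.
pose launch i := if i \in J then u i else x i.
(* For i outside [J], removing the fewer than k vertices of [GN i] forces the candidates out of
   [G]. *)
pose E i := if i \in J then R else GN i.
have cE i : #|E i| <= k.
  by rewrite /E; case: ifP => //; rewrite inE => /negbT; rewrite -ltnNge => /ltnW.
pose Z i := [set v | e (launch i) v] :\: (X :|: Y :|: U :|: H0 :|: E i).
(* From 22k out-neighbours, at most k are lost to each of [X], [Y], [H0], [E i], and 3k to [U]. *)
have cZ i : 15 * k <= #|Z i|.
  have := card_leq_setD [set v | e (launch i) v] (X :|: Y :|: U :|: H0 :|: E i).
  have := deg (launch i); rewrite /outdeg -/(Z i).
  have := card_setU_le (X :|: Y :|: U :|: H0) (E i).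
  have := card_setU_le (X :|: Y :|: U) H0.
  have := card_setU_le (X :|: Y) U.
  have := card_setU_le X Y.
  have := cE i; lia.
have ZP i z : z \in Z i ->
    [/\ z \in V, z \notin U, z \notin H0, z \notin R & e (launch i) z].
  rewrite !inE !negb_or => /andP[/andP[/andP[/andP[/andP[-> ->] ->] ->] zE] ez].
  rewrite ez; split=> //; apply: contra zE; rewrite /E; case: ifP => // iJ zR.
  by rewrite inE (RG _ zR); move: ez; rewrite /launch iJ.
(* The free vertex of U dominating z is [u i] if i is in [J]. Otherwise z lies outside [G], so more
   than k vertices of U dominate it and one of them starts no line. *)
have ZU i z : z \in Z i -> exists u0, [/\ u0 \in U, u0 \notin S & e u0 z].
  move=> zZ; have [zV zU _ _ ez] := ZP _ _ zZ.
  case: (boolP (i \in J)) => iJ.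
    by have [? ? _] := uP _ iJ; exists (u i); split=> //; rewrite /launch iJ in ez.
  have zG : z \notin G.
    rewrite /launch (negbTE iJ) in ez; move: zZ; rewrite inE /E (negbTE iJ) => /andP[+ _].
    by apply: contra => zG; rewrite in_setU; apply/orP; right; rewrite inE zG ez.
  have [|v] := @card_lt_notin T [set u in U | ~~ e z u] S.
    apply: leq_ltn_trans cS _; rewrite ltnNge; apply: contra zG => le.
    by rewrite inE le andbT inE zU.
  rewrite inE => /andP[vU ezv] vS; exists v; split=> //.
  by apply: semicomplete_arc ezv => //; apply: contraTneq vU => <-.
have ZF i z : z \in Z i -> z \notin F.
  case/ZP=> zV _ _ zR _; rewrite inE negb_or zR andbT.
  by move: zV; rewrite !inE negb_or => /andP[].
have Zoff i z j : z \in Z i -> z \notin s j :: p j.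
  move=> zZ; have [u0 [u0U u0S eu]] := ZU _ _ zZ; have [_ zU zH _ _] := ZP _ _ zZ.
  exact: off_line eu _ _.
have Zlow i z j q : z \in Z i -> e z q -> q \in s j :: p j -> q \in S :|: H0 :|: H1.
  move=> zZ; have [u0 [u0U u0S eu]] := ZU _ _ zZ; have [_ zU zH _ _] := ZP _ _ zZ.
  exact: low_line eu _ _ (ZF _ _ zZ).
have [z [zI zP]] : exists z : 'I_k -> T, injective z /\
    forall i, z i \in Z i /\ (e (z i) (s i) \/ 7 * k <= #|N (s i) :\: N (z i)|).
  apply: (@greedy_choice T k (fun i v => v \in Z i /\ (e v (s i) \/ 7 * k <= #|N (s i) :\: N v|))) => i D cD.
  have cZD : 14 * k <= #|Z i :\: D|.
    have := card_leq_setD (Z i) D; have := cZ i; lia.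
  case: (boolP [exists v in Z i :\: D, e v (s i)]) => [/exists_inP[v]|none].
    by rewrite inE => /andP[vD vZ] ev; exists v; split=> //; split=> //; left.
  have [||v] := @ex_large_indegree T e (Z i :\: D) (7 * k) sc; [lia|lia|].
  rewrite inE => /andP[vD vZ] big; exists v; split=> //; split=> //; right.
  have [vV vU _ _ _] := ZP _ _ vZ.
  (* No candidate has an arc to [s i], so the 7k in-neighbours of v among them lie in [N v] but not
     in [N (s i)]. As [s i] is in the top set U, the opposite difference is at least as large. *)
  have le1 : #|N v| <= #|N (s i)| by apply: topU; rewrite // inE vU.
  have le2 : 7 * k <= #|N v :\: N (s i)|.
    apply: leq_trans big _; apply: subset_leq_card; apply/subsetP => w.
    rewrite [w \in [set _ in _ | _]]inE => /andP[wZ ewv].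
    have nw : ~~ e w (s i) by apply: contra none => ews; apply/exists_inP; exists w.
    have [wV _ _ _ _] : [/\ w \in V, w \notin U, w \notin H0, w \notin R & e (launch i) w].
      by apply: ZP; move: wZ; rewrite inE => /andP[].
    by rewrite /N 3!inE wV ewv (negbTE nw).
  have := cardsID (N v) (N (s i)); have := cardsID (N (s i)) (N v).
  rewrite [N v :&: _]setIC; lia.
have zZ i : z i \in Z i by case: (zP i).
pose Zs := z @: [set: 'I_k].
pose Us := u @: J.
have [w [wI wP]] : exists w : 'I_k -> T, injective w /\
    forall i, ~~ e (z i) (s i) ->
      [/\ e (z i) (w i), e (w i) (s i), w i \in V & w i \notin R :|: Us :|: Zs] /\
      forall j, w i \notin s j :: p j.
  apply: (@greedy_choice T k (fun i v => ~~ e (z i) (s i) ->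
      [/\ e (z i) v, e v (s i), v \in V & v \notin R :|: Us :|: Zs] /\
      forall j, v \notin s j :: p j)) => i D cD.
  case: (boolP (e (z i) (s i))) => nez.
    have [|v _ vZ] := @card_lt_notin T setT D; first by rewrite cardsT; lia.
    by exists v.
  have big : 7 * k <= #|N (s i) :\: N (z i)| by case: (zP i) => _ []; rewrite ?(negbTE nez).
  (* Six sets of at most k vertices and the fewer than k earlier choices cannot cover 7k
     vertices. *)
  have [|v] := @card_lt_notin T (N (s i) :\: N (z i)) (R :|: Us :|: Zs :|: (S :|: H0 :|: H1) :|: D).
    have cUs : #|Us| <= k := card_ord_image _ _.
    have cZs : #|Zs| <= k := card_ord_image _ _.
    have := card_setU_le (R :|: Us :|: Zs :|: (S :|: H0 :|: H1)) D.
    have := card_setU_le (R :|: Us :|: Zs) (S :|: H0 :|: H1).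
    have := card_setU_le (R :|: Us) Zs.
    have := card_setU_le R Us.
    have := card_setU_le (S :|: H0) H1.
    have := card_setU_le S H0; lia.
  rewrite inE => /andP[vNz vNs].
  rewrite 2!in_setU !negb_or => /andP[/andP[vRUZ vL] vD].
  have [vV evs] : v \in V /\ e v (s i) by move: vNs; rewrite inE => /andP[].
  (* Since v is not an in-neighbour of [z i], semicompleteness turns the arc around; v differs from
     [z i] because only v has an arc to [s i]. *)
  have ezv : e (z i) v.
    apply: (@semicomplete_arc T e v) => //.
      by apply: contraTneq evs => ->.
    by apply: contra vNz => evz; rewrite inE vV.
  exists v; split=> // _; split=> // j.
  by apply: contra vL; apply: Zlow ezv.
have UsP v : v \in Us -> v \in U /\ forall j, v \notin s j :: p j.
  by case/imsetP=> i /uP[uU uS _] ->; split=> // j; apply: US.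
have VX v : v \in V -> v \notin X by rewrite !inE negb_or => /andP[].
have RU v : v \in R -> v \notin U by case/RG/GV.
(* The six kinds of vertices used by the walks are pairwise disjoint, so a
   common vertex of two walks has the same kind on both. *)
pose kind v := if v \in X then 0 else if v \in R then 1 else if v \in Us then 2
  else if v \in Zs then 3 else if [exists j, v \in s j :: p j] then 4 else 5.
pose own i v := match kind v with
  | 0 => v = x i | 1 => v = r i | 2 => v = u i | 3 => v = z i
  | 4 => v \in s i :: p i | _ => v = w i end.
have own_inj i j v : own i v -> own j v -> i = j.
  rewrite /own; case: (kind v) => [|[|[|[|[|n]]]]]; last by move=> -> /wI.
  - by move=> -> /xI.
  - by move=> -> /rI.
  - by move=> -> /uI.
  - by move=> -> /zI.
  - exact: dis.
have own_x i : own i (x i) by rewrite /own /kind imset_f.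
have own_r i : i \in J -> own i (r i).
  move=> iJ; have [/GV[riX _ _] _] := rP _ iJ.
  by rewrite /own /kind (negbTE riX) imset_f.
have own_u i : i \in J -> own i (u i).
  move=> iJ; have [uU _ _] := uP _ iJ.
  have uR : u i \notin R by apply: contraTN uU => /RU.
  by rewrite /own /kind (negbTE (UX _ uU)) (negbTE uR) imset_f.
have own_z i : own i (z i).
  have [/VX/negbTE zX zU _ /negbTE zR _] := ZP _ _ (zZ i).
  have /negbTE zUs : z i \notin Us by apply: contra zU => /UsP[].
  by rewrite /own /kind zX zR zUs imset_f.
have own_line i v : v \in s i :: p i -> own i v.
  move=> vi; have := lineF _ _ vi; rewrite inE negb_or => /andP[/negbTE vX /negbTE vR].
  have /negbTE vU : v \notin Us by apply: contraTN vi => /UsP[_ /(_ i)].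
  have /negbTE vZ : v \notin Zs by apply: contraTN vi => /imsetP[j _ ->]; apply: Zoff.
  have vL : [exists j, v \in s j :: p j] by apply/existsP; exists i.
  by rewrite /own /kind vX vR vU vZ vL.
have own_w i : ~~ e (z i) (s i) -> own i (w i).
  case/wP=> -[_ _ /VX/negbTE wX]; rewrite !in_setU !negb_or.
  case/andP=> /andP[/negbTE wR /negbTE wU] /negbTE wZ wL.
  have /negbTE wL' : ~~ [exists j, w i \in s j :: p j] by apply/existsP => -[j]; apply/negP.
  by rewrite /own /kind wX wR wU wZ wL'.
(* The walk is x_i, then r_i and u_i if i is in [J], then z_i, then w_i unless z_i has an arc to
   s_i, then the line from s_i to y_i. *)
exists (fun i => (if i \in J then [:: r i; u i] else [::]) ++
  z i :: (if e (z i) (s i) then [::] else [:: w i]) ++ s i :: p i).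
split=> [i|i j v vi vj].
  split; last by rewrite !(last_cat, last_cons); case: (sys i).
  have pp : path e (s i) (p i).
    by case: (sys i) => _ + _; apply: sub_path => a b /and3P[].
  have zs : path e (z i) ((if e (z i) (s i) then [::] else [:: w i]) ++ s i :: p i).
    by case: ifP => [ez|/negbT/wP[[ezw ews _ _] _]] /=; rewrite ?ez ?ezw ?ews pp.
  have [_ _ _ _] := ZP _ _ (zZ i); rewrite cat_path /launch.
  case: ifP => iJ ez /=; rewrite ez zs ?andbT //.
  by have [_ ->] := rP _ iJ; have [_ _ ->] := uP _ iJ.
suff ownP l : v \in x l :: (if l \in J then [:: r l; u l] else [::]) ++
    z l :: (if e (z l) (s l) then [::] else [:: w l]) ++ s l :: p l -> own l v.
  exact: own_inj (ownP _ vi) (ownP _ vj).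
rewrite inE => /orP[/eqP->//|]; rewrite mem_cat => /orP[|].
  by case: ifP => // lJ; rewrite !inE => /orP[]/eqP->; [apply: own_r | apply: own_u].
rewrite inE => /orP[/eqP->//|]; rewrite mem_cat => /orP[|]; last exact: own_line.
by case: ifP => // /negbT nez; rewrite inE => /eqP->; apply: own_w.
Qed.

Theorem theorem1p3 (k : nat) (T : finType) (e : rel T) :
  2 <= k ->
  irreflexive e ->
  semicomplete e ->
  strong e (3 * k) ->
  22 * k <= min_outdeg e ->
  linked e k.
Proof.
move=> k2 irr sc str deg; split; first by case: str; lia.
move=> x y xI yI xy.
have deg' v : 22 * k <= outdeg e v by apply: leq_trans deg (min_outdeg_le e v).
have [W [pW dW]] := link_terminals (ltnW k2) irr sc str deg' xI yI xy.
(* Shortening a walk to a path only drops vertices, so disjointness survives. *)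
have short i v : v \in x i :: shorten (x i) (W i) -> v \in x i :: W i.
  have [pp _] := pW i; case/shortenP: pp => q _ _ sq.
  by rewrite !inE => /orP[->|/sq ->]; rewrite ?orbT.
exists (fun i => shorten (x i) (W i)); split=> [i|i j ne].
  have [pp <-] := pW i; rewrite /dipath.
  by case/shortenP: pp => q -> -> _; rewrite eqxx.
rewrite disjoint_has; apply/hasPn => v /short vi; apply/negP => /= /short vj.
by case/eqP: ne; apply: dW vi vj.
Qed.
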